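(* Let $f_{orig}:D_{(u,v)}\to\mathbb R^3$ be a $C^2$ regular immersion with Gauss curvature $K=-1$, and let $T:\breve D_{(x,y)}\to\breve D_{(u,v)}\subset D_{(u,v)}$ be a local $C^1$ reparametrization of $f_{orig}$ by asymptotic Chebyshev coordinates, so that $f=f_{asyche}:=f_{orig}\circ T$ is $C^{1M}$. Let $\theta\in(0,\pi)$ be the angle from $f_x$ to $f_y$ and let $N=N_{asyche}=\dfrac{f_x\times f_y}{\sin\theta}$, with the coordinates $x,y$ labelled so that $f_{xy}=\sin\theta\,N$. Then $N$ is $C^{1M}$, $N_{xy}=N_{yx}=\cos\theta\,N$, $f_x=N\times N_x$ and $f_y=-N\times N_y$.
   Context: $D_{(u,v)}\subset\mathbb R^2$ is a simply connected open set, and $\breve D_{(x,y)},\breve D_{(u,v)}$ denote appropriate small open domains; $T$ is a $C^1$ diffeomorphism between them. A $C^1$ map $g$ is $C^{1M}$ (with respect to $(x,y)$) if its mixed second partials $g_{xy},g_{yx}$ exist, are continuous and are equal. A $C^1$ map is regular if it has rank $2$ everywhere. $f$ is Chebyshev if $\langle f_x,f_x\rangle=\langle f_y,f_y\rangle=1$, and asymptotic if all parameter curves are asymptotic curves (tangent to directions in which the second fundamental form vanishes), i.e. $\langle f_x,N_x\rangle=0=\langle f_y,N_y\rangle$. The existence, locally, of such a $T$ (unique up to orientations) with $f_{orig}\circ T$ of class $C^{1M}$ is a theorem of Hartman and Wintner. For $C^{1M}$ regular $f$ with $C^1$ unit normal $N$: $E=\langle f_x,f_x\rangle$, $F=\langle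 f_x,f_y\rangle$, $G=\langle f_y,f_y\rangle$, $\ell=-\langle f_x,N_x\rangle$, $n=-\langle f_y,N_y\rangle$, $m=\langle f_{xy},N\rangle$, $K=(\ell n-m^2)/(EG-F^2)$. For asymptotic Chebyshev $f$ with $K=-1$ one has $\langle f_x,f_y\rangle=\cos\theta$ and $f_{xy}=\pm\sin\theta\,N$, and interchanging $x$ and $y$ changes the sign. *)

(* Defs.v *)
From HB Require Import structures.
From mathcomp Require Import all_boot all_order all_algebra.
From mathcomp Require Import all_classical all_reals all_analysis.

Set Implicit Arguments.
Unset Strict Implicit.
Unset Printing Implicit Defensive.

Import Order.TTheory GRing.Theory Num.Theory.
Import numFieldNormedType.Exports.

Local Open Scope classical_set_scope.
Local Open Scope ring_scope.

Section Euclidean3.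
Context {R : realType}.
Implicit Types u v : 'rV[R]_3.

Definition dot u v : R := \sum_i u 0 i * v 0 i.

(* The norm `|u| of the library on 'rV[R]_3 is the max norm; this is the
   Euclidean one. *)
Definition enorm u : R := Num.sqrt (dot u u).

(* Indices are added in 'I_3, i.e. modulo 3. *)
Definition cross u v : 'rV[R]_3 :=
  \row_i (u 0 (i + 1) * v 0 (i + 2%:R) - u 0 (i + 2%:R) * v 0 (i + 1)).

Definition is_angle u v (t : R) : Prop :=
  0 < t < pi /\ dot u v = enorm u * enorm v * cos t.

End Euclidean3.

Section Plane.
Context {R : realType}.
Notation plane := 'rV[R]_2.

Definition domain (D : set plane) : Prop :=
  [/\ open D, connected D & D !=set0].

(* Paths and homotopies are total functions of which only the restriction to
   [0, 1] (resp. [0, 1]^2) matters; H (s, t) is the position at time t of the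
   s-th loop, all loops being based at p. *)
Definition simply_connected (D : set plane) : Prop :=
  [/\ D !=set0,
      (forall p q, D p -> D q ->
        exists c : R -> plane,
          [/\ {within `[0, 1], continuous c}, c @` `[0, 1] `<=` D,
              c 0 = p & c 1 = q]) &
      (forall (p : plane) (c : R -> plane),
        {within `[0, 1], continuous c} -> c @` `[0, 1] `<=` D ->
        c 0 = p -> c 1 = p ->
        exists H : R * R -> plane,
          [/\ {within `[0, 1] `*` `[0, 1], continuous H},
              H @` (`[0, 1] `*` `[0, 1]) `<=` D,
              (forall t, t \in `[0, 1] -> H (0, t) = c t /\ H (1, t) = p) &
              (forall s, s \in `[0, 1] -> H (s, 0) = p /\ H (s, 1) = p)])].

Section Smoothness.
Context {W : normedModType R}.
Implicit Types (D : set plane) (g : plane -> W).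

(* g_x and g_y; the mixed derivative g_xy is partial2 (partial1 g). *)
Definition partial1 g : plane -> W := 'D_(delta_mx 0 0) g.
Definition partial2 g : plane -> W := 'D_(delta_mx 0 1) g.

Definition C1 D g : Prop := forall p, D p ->
  [/\ differentiable g p,
      {for p, continuous (partial1 g)} & {for p, continuous (partial2 g)}].

Definition C2 D g : Prop := [/\ C1 D g, C1 D (partial1 g) & C1 D (partial2 g)].

Definition C1M D g : Prop := C1 D g /\
  forall p, D p ->
    [/\ derivable (partial1 g) p (delta_mx 0 1),
        derivable (partial2 g) p (delta_mx 0 0),
        {for p, continuous (partial2 (partial1 g))},
        {for p, continuous (partial1 (partial2 g))} &
        partial2 (partial1 g) p = partial1 (partial2 g) p].

End Smoothness.

Definition C1_diffeomorphism (A B : set plane) (T : plane -> plane) : Prop :=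
  exists S : plane -> plane,
    [/\ C1 A T, C1 B S,
        (forall p, A p -> B (T p) /\ S (T p) = p) &
        (forall q, B q -> A (S q) /\ T (S q) = q)].

Section Surface.
Implicit Types (D : set plane) (f : plane -> 'rV[R]_3) (p : plane).

Definition regular D f : Prop :=
  C1 D f /\ forall p, D p -> \rank (jacobian f p) = 2%N.

Definition unit_normal f p : 'rV[R]_3 :=
  let w := cross (partial1 f p) (partial2 f p) in (enorm w)^-1 *: w.

Definition ffE f p : R := dot (partial1 f p) (partial1 f p).
Definition ffF f p : R := dot (partial1 f p) (partial2 f p).
Definition ffG f p : R := dot (partial2 f p) (partial2 f p).

(* The pure second derivatives of f need not exist, hence these formulas for
   the diagonal coefficients of the second fundamental form. *)
Definition sf_l f p : R := - dot (partial1 f p) (partial1 (unit_normal f) p).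
Definition sf_n f p : R := - dot (partial2 f p) (partial2 (unit_normal f) p).
Definition sf_m f p : R := dot (partial2 (partial1 f) p) (unit_normal f p).

Definition gauss_curvature f p : R :=
  (sf_l f p * sf_n f p - sf_m f p ^+ 2) / (ffE f p * ffG f p - ffF f p ^+ 2).

Definition chebyshev_coords D f : Prop :=
  forall p, D p -> ffE f p = 1 /\ ffG f p = 1.

Definition asymptotic_coords D f : Prop :=
  forall p, D p ->
    dot (partial1 f p) (partial1 (unit_normal f) p) = 0 /\
    dot (partial2 f p) (partial2 (unit_normal f) p) = 0.

End Surface.
End Plane.

(* Main.v *)
Require Import Defs.
From mathcomp Require Import all_boot all_order all_algebra.
From mathcomp Require Import all_classical all_reals all_analysis.
From mathcomp Require Import ring.

(** Write a = f_x, b = f_y, s = sin theta and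
c = cos theta, so that a and b are unit vectors, <a, b> = c, N = (a x b) / s
is the unit normal and f_xy = s N.

The substance is that N has first derivatives at all: f is only of class C1M,
and f_xx, f_yy need not exist, so N cannot be differentiated through its
formula.  But the normal direction does not depend on the parametrization.
The normal of forig is C1 because forig is C2, and by the chain rule
f_x x f_y is det(DT) times the corresponding product for forig; hence N is the
normal of forig composed with T, up to the sign of det(DT).  As T is C1 and
det(DT) does not vanish, this sign is locally constant, and N is
differentiable (differentiable_unit_normal_comp).

The rest is linear algebra in the moving frame (a, b, N).  Differentiating
<N, N> = 1, <N, b> = 0 and <N, a> = 0, with the asymptotic conditions
<a, N_x> = <b, N_y> = 0 and with f_xy = s N, gives all products of N_x and N_y
with the frame:
  <N_x, a> = <N_x, N> = 0, <N_x, b> = - s,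
  <N_y, b> = <N_y, N> = 0, <N_y, a> = - s.
The only vectors with these products are N_x = a x N and N_y = N x b
(tangent_frame, partials_N).  These formulas invert to a = N x N_x and
b = - N x N_y.  They also express the first derivatives of N by the continuous
maps a, b, N, which makes N of class C1, and each right-hand side can be
differentiated in the other variable:
  N_xy = f_xy x N + a x N_y = s (N x N) + a x (N x b) = c N,
and likewise N_yx = c N.  Since c = <a, b>, the mixed derivative is
continuous. *)

Set Implicit Arguments.
Unset Strict Implicit.
Unset Printing Implicit Defensive.

Import Order.TTheory GRing.Theory Num.Theory.
Import numFieldNormedType.Exports.

Local Open Scope classical_set_scope.
Local Open Scope ring_scope.

(** * Vector algebra in three dimensions *)

Section CrossProduct.
Context {R : realType}.
Implicit Types u v w : 'rV[R]_3.

Lemma dotE u v : dot u v = u 0 0 * v 0 0 + u 0 1 * v 0 1 + u 0 2%:R * v 0 2%:R.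
Proof.
rewrite /dot !big_ord_recl big_ord0 addr0 addrA.
by congr (_ + _ + _); congr (u 0 _ * v 0 _); apply/val_inj.
Qed.

Lemma row3P u v :
  u 0 0 = v 0 0 -> u 0 1 = v 0 1 -> u 0 2%:R = v 0 2%:R -> u = v.
Proof.
move=> uv0 uv1 uv2; apply/rowP => -[[|[|[|//]]] i3].
- by rewrite (_ : Ordinal i3 = 0)//; apply/val_inj.
- by rewrite (_ : Ordinal i3 = 1)//; apply/val_inj.
- by rewrite (_ : Ordinal i3 = 2%:R)//; apply/val_inj.
Qed.

Let crossE0 u v : cross u v 0 0 = u 0 1 * v 0 2%:R - u 0 2%:R * v 0 1.
Proof.
by rewrite mxE; congr (u 0 _ * v 0 _ - u 0 _ * v 0 _); apply/val_inj.
Qed.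

Let crossE1 u v : cross u v 0 1 = u 0 2%:R * v 0 0 - u 0 0 * v 0 2%:R.
Proof.
by rewrite mxE; congr (u 0 _ * v 0 _ - u 0 _ * v 0 _); apply/val_inj.
Qed.

Let crossE2 u v : cross u v 0 2%:R = u 0 0 * v 0 1 - u 0 1 * v 0 0.
Proof.
by rewrite mxE; congr (u 0 _ * v 0 _ - u 0 _ * v 0 _); apply/val_inj.
Qed.

Let oppE u i : (- u) 0 i = - u 0 i. Proof. by rewrite mxE. Qed.
Let addE u v i : (u + v) 0 i = u 0 i + v 0 i. Proof. by rewrite mxE. Qed.
Let scaleE (k : R) u i : (k *: u) 0 i = k * u 0 i. Proof. by rewrite mxE. Qed.
Let coordE := (dotE, crossE0, crossE1, crossE2, oppE, addE, scaleE).

Lemma crossC u v : cross u v = - cross v u.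
Proof. by apply: row3P; rewrite !coordE; ring. Qed.

Lemma cross_self u : cross u u = 0.
Proof. by apply: row3P; rewrite !coordE mxE; ring. Qed.

Lemma crossZl (k : R) u v : cross (k *: u) v = k *: cross u v.
Proof. by apply: row3P; rewrite !coordE; ring. Qed.

Lemma crossZr (k : R) u v : cross u (k *: v) = k *: cross u v.
Proof. by apply: row3P; rewrite !coordE; ring. Qed.

Lemma cross_lin2 (a b c d : R) u v :
  cross (a *: u + b *: v) (c *: u + d *: v) = (a * d - b * c) *: cross u v.
Proof. by apply: row3P; rewrite !coordE; ring. Qed.

Lemma dotC u v : dot u v = dot v u.
Proof. by rewrite !coordE; ring. Qed.

Lemma dotZl (k : R) u v : dot (k *: u) v = k * dot u v.
Proof. by rewrite !coordE; ring. Qed.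

Lemma dotZr (k : R) u v : dot u (k *: v) = k * dot u v.
Proof. by rewrite !coordE; ring. Qed.

Lemma dot_crossl u v : dot u (cross u v) = 0.
Proof. by rewrite !coordE; ring. Qed.

Lemma dot_crossr u v : dot v (cross u v) = 0.
Proof. by rewrite !coordE; ring. Qed.

Lemma dot_cross_cross u v :
  dot (cross u v) (cross u v) = dot u u * dot v v - dot u v ^+ 2.
Proof. by rewrite !coordE; ring. Qed.

Lemma cross_cross u v w :
  cross u (cross v w) = dot u w *: v - dot u v *: w.
Proof. by apply: row3P; rewrite !coordE; ring. Qed.

(** Expansion of w along the normal direction u x v and along the two tangent
directions v x (u x v) and (u x v) x u, which are dual to (u, v) up to
the factor |u x v|^2.  It recovers w from its products with the frame
(u, v, u x v). *)
Lemma cross_frame u v w : dot (cross u v) (cross u v) *: w =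
  dot w (cross u v) *: cross u v + dot w u *: cross v (cross u v)
  + dot w v *: cross (cross u v) u.
Proof. by apply: row3P; rewrite !coordE; ring. Qed.

Lemma dot_eq0 u : (dot u u == 0) = (u == 0).
Proof.
apply/eqP/eqP => [u0|->]; last by rewrite coordE !mxE !mul0r !addr0.
apply/rowP => i; rewrite mxE; apply/eqP; rewrite -sqrf_eq0 expr2; apply/eqP.
by apply: (psumr_eq0P _ u0) => // j _; rewrite -expr2 sqr_ge0.
Qed.

Lemma dot_ge0 u : 0 <= dot u u.
Proof. by apply: sumr_ge0 => i _; rewrite -expr2 sqr_ge0. Qed.

Lemma dot_gt0 u : u != 0 -> 0 < dot u u.
Proof. by move=> u0; rewrite lt_def dot_ge0 dot_eq0 u0. Qed.

Lemma enormZ (k : R) u : enorm (k *: u) = `|k| * enorm u.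
Proof.
by rewrite /enorm dotZl dotZr mulrA -expr2 sqrtrM ?sqr_ge0// sqrtr_sqr.
Qed.

(** Normalization forgets the length of a vector but keeps its orientation;
this is where the sign of the Jacobian of a reparametrization comes from. *)
Lemma normalizeZ (k : R) u :
  (enorm (k *: u))^-1 *: (k *: u) = Num.sg k *: ((enorm u)^-1 *: u).
Proof.
have [->|k0] := eqVneq k 0; first by rewrite sgr0 !scale0r scaler0.
have /mulVf kV : `|k| != 0 by rewrite normr_eq0.
rewrite enormZ !scalerA [X in _ * X]numEsg invfM; congr (_ *: _).
by rewrite -[RHS]mul1r -kV; ring.
Qed.

Lemma unit_angle (a b : 'rV[R]_3) (t : R) :
  dot a a = 1 -> dot b b = 1 -> is_angle a b t ->
  [/\ 0 < sin t, dot a b = cos t & enorm (cross a b) = sin t].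
Proof.
move=> aa bb [t0pi]; have sin0 : 0 < sin t by exact: sin_gt0_pi.
rewrite /enorm dot_cross_cross aa bb sqrtr1 !mul1r => ->; split => //.
by rewrite -sin2cos2 sqrtr_sqr gtr0_norm.
Qed.

(** The algebraic core: for unit vectors a, b at an angle with cosine c and
sine s, and n normal to both, the products prescribed to N_x and to N_y by the
asymptotic and Chebyshev conditions have a single solution each. *)
Lemma tangent_frame (a b n : 'rV[R]_3) (s c : R) :
  s != 0 -> s ^+ 2 = 1 - c ^+ 2 -> dot a a = 1 -> dot b b = 1 -> dot a b = c ->
  n = s^-1 *: cross a b ->
  [/\ dot n n = 1, dot n a = 0, dot n b = 0 &
    forall w, dot w n = 0 ->
      (dot w a = 0 -> dot w b = - s -> w = cross a n) /\
      (dot w b = 0 -> dot w a = - s -> w = cross n b)].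
Proof.
move=> s0 s2 aa bb ab ->.
have ww : dot (cross a b) (cross a b) = s ^+ 2.
  by rewrite dot_cross_cross aa bb ab s2 mulr1.
split.
- by rewrite dotZl dotZr ww; field.
- by rewrite dotZl dotC dot_crossl mulr0.
- by rewrite dotZl dotC dot_crossr mulr0.
move=> w; rewrite dotZr => /eqP.
rewrite mulf_eq0 invr_eq0 (negPf s0)/= => /eqP wn.
(* Multiplying by s ^+ 2 gives the left-hand side of cross_frame. *)
split=> [wa wb|wb wa]; apply: (scalerI (expf_neq0 2 s0)).
  rewrite -[in LHS]ww cross_frame wn wa wb !scale0r !add0r.
  rewrite crossC scalerN scaleNr opprK.
  by rewrite crossZr scalerA; congr (_ *: _); field.
rewrite -[in LHS]ww cross_frame wn wa wb !scale0r add0r addr0.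
rewrite crossC scalerN scaleNr opprK.
by rewrite crossZl scalerA; congr (_ *: _); field.
Qed.

End CrossProduct.

(** * Calculus of vector-valued maps *)

Section Calculus.
Context {R : realType} {V : normedModType R}.

Lemma near_open (D : set V) (P : V -> Prop) p :
  open D -> (forall q, D q -> P q) -> D p -> \forall q \near p, P q.
Proof. by move=> Do DP Dp; apply: filterS DP _; exact: open_nbhs_nbhs. Qed.

Lemma near_eq_continuous {W : normedModType R} (f g : V -> W) p :
  (\near p, g p = f p) -> {for p, continuous g} -> {for p, continuous f}.
Proof.
move=> gf; rewrite /prop_for /continuous_at (nbhs_singleton gf) => cg.
exact: cvg_trans (near_eq_cvg gf) cg.
Qed.

(** Differentiability is a local property: the differential of g at p is also a
first-order expansion of f at p. *)
Lemma near_eq_differentiable {W : normedModType R} (f g : V -> W) p :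
  (\near p, g p = f p) -> differentiable g p -> differentiable f p.
Proof.
move=> gf dg.
have cdg : continuous ('d g p) by exact: diff_continuous.
suff fE : f \o shift p = cst (f p) + 'd g p +o_ 0 id.
  by apply/diff_locallyP; rewrite (diff_unique cdg fE).
apply/eqaddoP => e e0.
have /eqaddoP/(_ _ e0) gE := diff_locally dg.
have {}gf : \forall h \near 0, g (h + p) = f (h + p).
  by have := gf; rewrite (near_shift 0)/= subr0.
near=> h.
suff <- : (g \o shift p - (cst (g p) + 'd g p)) h
        = (f \o shift p - (cst (f p) + 'd g p)) h by near: h.
have gfh : g (h + p) = f (h + p) by near: h.
by rewrite !fctE/= gfh; have := nbhs_singleton gf; rewrite add0r => ->.
Unshelve. all: by end_near. Qed.

Lemma derive_near_cst {W : normedModType R} (g : V -> W) (c : W) p v :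
  (\near p, g p = c) -> 'D_v g p = 0.
Proof. by move=> gc; rewrite (near_eq_derive (g := cst c))// derive_cst. Qed.

Lemma continuousZ {W : normedModType R} (k : V -> R) (g : V -> W) p :
  {for p, continuous k} -> {for p, continuous g} ->
  {for p, continuous (fun q => k q *: g q)}.
Proof. by move=> ck cg; exact: cvgZ. Qed.

(** Makes the orientation of a C1 change of parameters locally constant. *)
Lemma continuous_near_sg (j : V -> R) p : {for p, continuous j} -> j p != 0 ->
  \forall q \near p, Num.sg (j q) = Num.sg (j p).
Proof.
move=> cj; rewrite neq_lt => /orP[j0|j0].
- have jn : \forall q \near p, j q < 0 by exact: cvgr_lt cj _ j0.
  by near=> q; rewrite (ltr0_sg j0) ltr0_sg//; near: q.
- have jn : \forall q \near p, 0 < j q by exact: cvgr_gt cj _ j0.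
  by near=> q; rewrite (gtr0_sg j0) gtr0_sg//; near: q.
Unshelve. all: by end_near. Qed.

Section Row.
Context {n : nat}.
Implicit Types g : V -> 'rV[R]_n.

Let rowE g : g = fun p => \sum_i g p 0 i *: delta_mx 0 i.
Proof. by apply/funext => p; exact: row_sum_delta. Qed.

Lemma differentiable_rV g p :
  (forall i, differentiable (fun q => g q 0 i) p) -> differentiable g p.
Proof.
move=> dg; rewrite (rowE g).
have -> : (fun p => \sum_i g p 0 i *: delta_mx 0 i) =
   \sum_i (fun p => g p 0 i *: (delta_mx 0 i : 'rV_n)).
  by apply/funext => q; rewrite fct_sumE.
by apply: differentiable_sum => i; exact: differentiableZl.
Qed.

Lemma differentiable_rV_coord g p i :
  differentiable g p -> differentiable (fun q => g q 0 i) p.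
Proof.
move=> dg; apply: (@differentiable_comp _ _ _ _ g (fun M => M 0 i)) => //.
exact: differentiable_coord.
Qed.

Lemma continuous_rV g p :
  (forall i, {for p, continuous (fun q => g q 0 i)}) -> {for p, continuous g}.
Proof.
move=> cg; rewrite /prop_for /continuous_at {1}(rowE g).
rewrite [X in _ --> X]row_sum_delta.
apply: cvg_big => [|i _]; first exact: add_continuous.
by apply: cvgZr_tmp; exact: cg.
Qed.

Lemma continuous_rV_coord g p i :
  {for p, continuous g} -> {for p, continuous (fun q => g q 0 i)}.
Proof.
move=> cg; apply: (@continuous_comp _ _ _ g (fun M => M 0 i)) => //.
exact: coord_continuous.
Qed.

Lemma is_derive_rV g p v (dg : 'rV[R]_n) :
  (forall i, is_derive p v (fun q => g q 0 i) (dg 0 i)) -> is_derive p v g dg.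
Proof.
move=> dgi.
have dgp : derivable g p v by apply/derivable_mxP => i j; rewrite ord1.
apply: DeriveDef => //; rewrite derive_mx//; apply/rowP => i.
by rewrite mxE derive_val.
Qed.

Lemma is_derive_rV_coord g p v (dg : 'rV[R]_n) i :
  is_derive p v g dg -> is_derive p v (fun q => g q 0 i) (dg 0 i).
Proof.
move=> [gp <-]; apply: DeriveDef.
  by move/derivable_mxP : gp; exact.
by rewrite derive_mx// mxE.
Qed.

End Row.

Lemma continuous_minor {n : nat} (g h : V -> 'rV[R]_n) p i j :
  {for p, continuous g} -> {for p, continuous h} ->
  {for p, continuous (fun q => g q 0 i * h q 0 j - g q 0 j * h q 0 i)}.
Proof.
by move=> cg ch; apply: cvgB; apply: cvgM; exact: continuous_rV_coord.
Qed.

Implicit Types g h : V -> 'rV[R]_3.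

(** The product rules for dot and cross ask only for derivatives along the one
direction v.  This is all that a C1M map offers: f_x can be differentiated
along y but possibly not along x. *)
Lemma is_derive_dot g h p v dg dh :
  is_derive p v g dg -> is_derive p v h dh ->
  is_derive p v (fun q => dot (g q) (h q)) (dot dg (h p) + dot (g p) dh).
Proof.
move=> gd hd.
have gi i := is_derive_rV_coord i gd.
have hi i := is_derive_rV_coord i hd.
have -> : (fun q => dot (g q) (h q)) =
   \sum_i ((fun q => g q 0 i) * (fun q => h q 0 i)).
  by apply/funext => q; rewrite fct_sumE.
apply: is_derive_eq.
rewrite /dot -big_split/=; apply: eq_bigr => i _.
by rewrite addrC /GRing.scale/= [_ * h _ _ _]mulrC.
Qed.

Lemma dot_derive_near_cst g h (c : R) p v dg dh :
  is_derive p v g dg -> is_derive p v h dh ->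
  (\near p, dot (g p) (h p) = c) -> dot dg (h p) + dot (g p) dh = 0.
Proof.
by move=> gd hd /(derive_near_cst v) <-; have [_ <-] := is_derive_dot gd hd.
Qed.

Lemma is_derive_cross g h p v dg dh :
  is_derive p v g dg -> is_derive p v h dh ->
  is_derive p v (fun q => cross (g q) (h q)) (cross dg (h p) + cross (g p) dh).
Proof.
move=> gd hd; apply: is_derive_rV => i.
have gi j := is_derive_rV_coord j gd.
have hi j := is_derive_rV_coord j hd.
have -> : (fun q => cross (g q) (h q) 0 i) =
    (fun q => g q 0 (i + 1)) * (fun q => h q 0 (i + 2%:R))
  - (fun q => g q 0 (i + 2%:R)) * (fun q => h q 0 (i + 1)).
  by apply/funext => q; rewrite mxE.
apply: is_derive_eq; rewrite /GRing.scale/= !mxE; ring.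
Qed.

Lemma differentiable_dot g h p :
  differentiable g p -> differentiable h p ->
  differentiable (fun q => dot (g q) (h q)) p.
Proof.
move=> gd hd.
have -> : (fun q => dot (g q) (h q)) =
   \sum_i ((fun q => g q 0 i) * (fun q => h q 0 i)).
  by apply/funext => q; rewrite fct_sumE.
by apply: differentiable_sum => i; apply: differentiableM;
  exact: differentiable_rV_coord.
Qed.

Lemma differentiable_cross g h p :
  differentiable g p -> differentiable h p ->
  differentiable (fun q => cross (g q) (h q)) p.
Proof.
move=> gd hd; apply: differentiable_rV => i.
have -> : (fun q => cross (g q) (h q) 0 i) =
    (fun q => g q 0 (i + 1)) * (fun q => h q 0 (i + 2%:R))
  - (fun q => g q 0 (i + 2%:R)) * (fun q => h q 0 (i + 1)).
  by apply/funext => q; rewrite mxE.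
by apply: differentiableB; apply: differentiableM;
  exact: differentiable_rV_coord.
Qed.

Lemma continuous_dot g h p :
  {for p, continuous g} -> {for p, continuous h} ->
  {for p, continuous (fun q => dot (g q) (h q))}.
Proof.
move=> cg ch; apply: cvg_big => [|i _]; first exact: add_continuous.
by apply: cvgM; exact: continuous_rV_coord.
Qed.

Lemma continuous_cross g h p :
  {for p, continuous g} -> {for p, continuous h} ->
  {for p, continuous (fun q => cross (g q) (h q))}.
Proof.
move=> cg ch; apply: continuous_rV => i.
have -> : (fun q => cross (g q) (h q) 0 i) =
    (fun q => g q 0 (i + 1) * h q 0 (i + 2%:R)
            - g q 0 (i + 2%:R) * h q 0 (i + 1)).
  by apply/funext => q; rewrite mxE.
exact: continuous_minor.
Qed.

Lemma differentiable_enorm g p :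
  differentiable g p -> g p != 0 -> differentiable (fun q => enorm (g q)) p.
Proof.
move=> dg /dot_gt0 gp0.
apply: (@differentiable_comp _ _ _ _ (fun q => dot (g q) (g q)) Num.sqrt).
  exact: differentiable_dot.
by apply/derivable1_diffP; have [] := is_derive1_sqrt gp0.
Qed.

End Calculus.

(** * The unit normal under a change of parameters *)

Section Plane.
Context {R : realType}.
Notation plane := 'rV[R]_2.
Implicit Types (g : plane -> 'rV[R]_3) (T : plane -> plane).

Section Partials.
Context {W : normedModType R}.

Lemma is_derive_partial1 (g : plane -> W) p : derivable g p (delta_mx 0 0) ->
  is_derive p (delta_mx 0 0) g (partial1 g p).
Proof. exact: derivableP. Qed.

Lemma is_derive_partial2 (g : plane -> W) p : derivable g p (delta_mx 0 1) ->
  is_derive p (delta_mx 0 1) g (partial2 g p).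
Proof. exact: derivableP. Qed.

Lemma partial1_val (g : plane -> W) p dg :
  is_derive p (delta_mx 0 0) g dg -> partial1 g p = dg.
Proof. by case. Qed.

Lemma partial2_val (g : plane -> W) p dg :
  is_derive p (delta_mx 0 1) g dg -> partial2 g p = dg.
Proof. by case. Qed.

Lemma near_eq_partial1 (g h : plane -> W) p :
  (\near p, g p = h p) -> partial1 g p = partial1 h p.
Proof. exact: near_eq_derive. Qed.

Lemma near_eq_partial2 (g h : plane -> W) p :
  (\near p, g p = h p) -> partial2 g p = partial2 h p.
Proof. exact: near_eq_derive. Qed.

End Partials.

Definition jacobian_det T p : R :=
  partial1 T p 0 0 * partial2 T p 0 1 - partial1 T p 0 1 * partial2 T p 0 0.

Lemma derive_comp2 g T p v :
  differentiable T p -> differentiable g (T p) ->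
  'D_v (g \o T) p = ('D_v T p) 0 0 *: partial1 g (T p)
                  + ('D_v T p) 0 1 *: partial2 g (T p).
Proof.
move=> dT dg; rewrite /partial1 /partial2 !deriveE//; last first.
  exact: differentiable_comp.
have dgT := @diff_comp _ _ _ _ T g p dT dg.
rewrite [LHS](congr1 (fun h => h v) dgT).
rewrite [LHS]/=; set u := 'd T p v.
have -> : 'd g (T p) u =
    'd g (T p) (u 0 0 *: delta_mx 0 0 + u 0 1 *: delta_mx 0 1).
  congr ('d g (T p) _); rewrite {1}(row_sum_delta u).
  rewrite !big_ord_recl big_ord0 addr0.
  by congr (_ + u 0 _ *: delta_mx 0 _); apply/val_inj.
by rewrite linearD !linearZ.
Qed.

Lemma cross_partials_comp g T p :
  differentiable T p -> differentiable g (T p) ->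
  cross (partial1 (g \o T) p) (partial2 (g \o T) p) =
  jacobian_det T p *: cross (partial1 g (T p)) (partial2 g (T p)).
Proof.
move=> dT dg; rewrite [partial1 _ p](derive_comp2 _ dT dg).
by rewrite [partial2 _ p](derive_comp2 _ dT dg) cross_lin2.
Qed.

#[local] Opaque dot cross enorm partial1 partial2.

(** The normal line is geometric; a change of parameters only affects the
orientation. *)
Lemma unit_normal_comp g T p :
  differentiable T p -> differentiable g (T p) ->
  unit_normal (g \o T) p = Num.sg (jacobian_det T p) *: unit_normal g (T p).
Proof.
move=> dT dg; have wE := cross_partials_comp dT dg.
rewrite /unit_normal wE.
exact: normalizeZ.
Qed.

Lemma differentiable_unit_normal g q :
  differentiable (partial1 g) q -> differentiable (partial2 g) q ->
  cross (partial1 g q) (partial2 g q) != 0 -> differentiable (unit_normal g) q.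
Proof.
move=> d1 d2 w0.
have dw := differentiable_cross d1 d2.
have den := differentiable_enorm dw w0.
apply: differentiable_rV => i.
have -> : (fun x => unit_normal g x 0 i) =
  (fun x => (enorm (cross (partial1 g x) (partial2 g x)))^-1) *
  (fun x => cross (partial1 g x) (partial2 g x) 0 i).
  by apply/funext => x; rewrite mxE.
apply: differentiableM; last exact: differentiable_rV_coord.
by apply: differentiableV => //; rewrite gt_eqF// sqrtr_gt0 dot_gt0.
Qed.

Lemma near_eq_unit_normal (f g : plane -> 'rV[R]_3) p :
  (\near p, f p = g p) -> unit_normal f p = unit_normal g p.
Proof.
by move=> fg; rewrite /unit_normal (near_eq_partial1 fg) (near_eq_partial2 fg).
Qed.

Lemma continuous_jacobian_det T p :
  {for p, continuous (partial1 T)} -> {for p, continuous (partial2 T)} ->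
  {for p, continuous (jacobian_det T)}.
Proof. by move=> c1 c2; exact: continuous_minor c1 c2. Qed.

(** The normal of g \o T inherits the regularity of the normal of g, although
the partial derivatives of g \o T need not be differentiable: near p it is a
constant sign times (unit_normal g) \o T. *)
Lemma differentiable_unit_normal_comp g T p :
  (\near p, differentiable T p) ->
  (\near p, differentiable g (T p)) ->
  {for p, continuous (partial1 T)} -> {for p, continuous (partial2 T)} ->
  differentiable (partial1 g) (T p) -> differentiable (partial2 g) (T p) ->
  cross (partial1 (g \o T) p) (partial2 (g \o T) p) != 0 ->
  differentiable (unit_normal (g \o T)) p.
Proof.
move=> dT dg c1 c2 d1 d2.
have dTp := nbhs_singleton dT.
rewrite (cross_partials_comp dTp (nbhs_singleton dg)).
(* The product det(DT) (g_u x g_v) is nonzero, hence so are both factors. *)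
rewrite scaler_eq0 negb_or => /andP[j0 w0].
have cj := continuous_jacobian_det c1 c2.
have sgj : \forall q \near p,
    Num.sg (jacobian_det T q) = Num.sg (jacobian_det T p).
  exact: continuous_near_sg cj j0.
apply: (@near_eq_differentiable _ _ _ _
    (Num.sg (jacobian_det T p) \*: (unit_normal g \o T))).
  near=> q.
  have dTq : differentiable T q by near: q.
  have dgq : differentiable g (T q) by near: q.
  have sgq : Num.sg (jacobian_det T q) = Num.sg (jacobian_det T p) by near: q.
  have gTq := unit_normal_comp dTq dgq.
  rewrite sgq in gTq.
  exact: esym gTq.
apply: differentiableZ.
apply: (@differentiable_comp _ _ _ _ T (unit_normal g)).
  exact: dTp.
exact: (differentiable_unit_normal d1 d2 w0).
Unshelve. all: by end_near. Qed.

End Plane.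

(** * The normal in asymptotic Chebyshev coordinates *)

Section AsymptoticChebyshev.
Context {R : realType}.
Notation plane := 'rV[R]_2.

#[local] Opaque dot cross enorm partial1 partial2.

Variables (D : set plane) (f N : plane -> 'rV[R]_3) (theta : plane -> R).
Hypotheses (D_open : open D) (f_C1M : C1M D f)
  (f_asymptotic : asymptotic_coords D f) (f_chebyshev : chebyshev_coords D f)
  (theta_angle : forall p, D p ->
     is_angle (partial1 f p) (partial2 f p) (theta p))
  (N_def : forall p, D p ->
     N p = (sin (theta p))^-1 *: cross (partial1 f p) (partial2 f p))
  (f_xy : forall p, D p ->
     partial2 (partial1 f) p = sin (theta p) *: N p).

Lemma unit_partials p : D p ->
  dot (partial1 f p) (partial1 f p) = 1 /\ dot (partial2 f p) (partial2 f p) = 1.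
Proof. exact: f_chebyshev. Qed.

Lemma angle_at p : D p ->
  [/\ 0 < sin (theta p), dot (partial1 f p) (partial2 f p) = cos (theta p) &
    enorm (cross (partial1 f p) (partial2 f p)) = sin (theta p)].
Proof.
move=> Dp; have [aa bb] := unit_partials Dp.
exact: (unit_angle aa bb (theta_angle Dp)).
Qed.

Lemma dot_partials p : D p -> dot (partial1 f p) (partial2 f p) = cos (theta p).
Proof. by case/angle_at. Qed.

Lemma unit_normalE p : D p -> unit_normal f p = N p.
Proof.
by move=> Dp; have [_ _ e] := angle_at Dp; rewrite (N_def Dp) /unit_normal e.
Qed.

Lemma frame_at p : D p ->
  let a := partial1 f p in let b := partial2 f p in
  [/\ dot (N p) (N p) = 1, dot (N p) a = 0, dot (N p) b = 0 &
    forall w, dot w (N p) = 0 ->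
      (dot w a = 0 -> dot w b = - sin (theta p) -> w = cross a (N p)) /\
      (dot w b = 0 -> dot w a = - sin (theta p) -> w = cross (N p) b)].
Proof.
move=> Dp a b; have [s0 ab _] := angle_at Dp.
have [aa bb] := unit_partials Dp.
exact: (tangent_frame (lt0r_neq0 s0) (sin2cos2 _) aa bb ab (N_def Dp)).
Qed.

Hypothesis N_diff : forall p, D p -> differentiable N p.

Lemma is_derive_N1 p : D p -> is_derive p (delta_mx 0 0) N (partial1 N p).
Proof. by move=> /N_diff/diff_derivable Np; exact: is_derive_partial1. Qed.

Lemma is_derive_N2 p : D p -> is_derive p (delta_mx 0 1) N (partial2 N p).
Proof. by move=> /N_diff/diff_derivable Np; exact: is_derive_partial2. Qed.

(** A curve of unit vectors moves orthogonally to itself. *)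
Lemma dot_derive_N_N p v dN : D p -> is_derive p v N dN -> dot dN (N p) = 0.
Proof.
move=> Dp Nd.
have NN : \near p, dot (N p) (N p) = 1.
  by apply: near_open D_open _ Dp => q /frame_at[].
have /eqP := dot_derive_near_cst Nd Nd NN.
by rewrite [X in _ + X]dotC -mulr2n mulrn_eq0/= => /eqP.
Qed.

(** The Weingarten equations.  The products <N_x, f_x> and <N_y, f_y> vanish
since the coordinates are asymptotic; <N_x, f_y> = <N_y, f_x> = - sin theta
follows by differentiating <N, f_y> = <N, f_x> = 0 and using the given value of
f_xy; and these determine N_x and N_y by tangent_frame. *)
Lemma partials_N p : D p ->
  partial1 N p = cross (partial1 f p) (N p) /\
  partial2 N p = cross (N p) (partial2 f p).
Proof.
move=> Dp; have [NN Na Nb uniq] := frame_at Dp.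
have [_ /(_ p Dp)[d21 d12 _ _ fxyC]] := f_C1M.
have nearN : \near p, unit_normal f p = N p.
  exact: near_open D_open unit_normalE Dp.
have [aN bN] := f_asymptotic Dp.
rewrite (near_eq_partial1 nearN) dotC in aN.
rewrite (near_eq_partial2 nearN) dotC in bN.
have Nx_b : dot (partial1 N p) (partial2 f p) = - sin (theta p).
  have nb : \near p, dot (N p) (partial2 f p) = 0.
    by apply: near_open D_open _ Dp => q /frame_at[].
  have : dot (partial1 N p) (partial2 f p)
       + dot (N p) (partial1 (partial2 f) p) = 0.
    exact: dot_derive_near_cst (is_derive_N1 Dp) (is_derive_partial1 d12) nb.
  by rewrite -fxyC (f_xy Dp) dotZr NN mulr1 => /eqP; rewrite addr_eq0 => /eqP.
have Ny_a : dot (partial2 N p) (partial1 f p) = - sin (theta p).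
  have na : \near p, dot (N p) (partial1 f p) = 0.
    by apply: near_open D_open _ Dp => q /frame_at[].
  have : dot (partial2 N p) (partial1 f p)
       + dot (N p) (partial2 (partial1 f) p) = 0.
    exact: dot_derive_near_cst (is_derive_N2 Dp) (is_derive_partial2 d21) na.
  by rewrite (f_xy Dp) dotZr NN mulr1 => /eqP; rewrite addr_eq0 => /eqP.
split.
  by have [h _] := uniq _ (dot_derive_N_N Dp (is_derive_N1 Dp)); exact: h.
by have [_ h] := uniq _ (dot_derive_N_N Dp (is_derive_N2 Dp)); exact: h.
Qed.

(** N_x = f_x x N can be differentiated along y because both factors can; the
term f_xy x N drops out, as f_xy is normal to the surface. *)
Lemma is_derive_partial1_N p : D p ->
  is_derive p (delta_mx 0 1) (partial1 N) (cos (theta p) *: N p).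
Proof.
move=> Dp; have [NN Na Nb _] := frame_at Dp.
have [_ /(_ p Dp)[d21 _ _ _ _]] := f_C1M.
have NxE : \near p, cross (partial1 f p) (N p) = partial1 N p.
  by apply: near_open D_open _ Dp => q /partials_N[].
apply: near_eq_is_derive NxE _.
suff <- : cross (partial2 (partial1 f) p) (N p)
        + cross (partial1 f p) (partial2 N p) = cos (theta p) *: N p.
  exact: is_derive_cross (is_derive_partial2 d21) (is_derive_N2 Dp).
have [_ ->] := partials_N Dp.
rewrite (f_xy Dp) crossZl cross_self scaler0 add0r cross_cross dot_partials//.
by rewrite [dot _ (N p)]dotC Na scale0r subr0.
Qed.

(** Here the term N x f_yx drops out, as f_yx = f_xy is normal. *)
Lemma is_derive_partial2_N p : D p ->
  is_derive p (delta_mx 0 0) (partial2 N) (cos (theta p) *: N p).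
Proof.
move=> Dp; have [NN Na Nb _] := frame_at Dp.
have [_ /(_ p Dp)[_ d12 _ _ fxyC]] := f_C1M.
have NyE : \near p, cross (N p) (partial2 f p) = partial2 N p.
  by apply: near_open D_open _ Dp => q /partials_N[].
apply: near_eq_is_derive NyE _.
suff <- : cross (partial1 N p) (partial2 f p)
        + cross (N p) (partial1 (partial2 f) p) = cos (theta p) *: N p.
  exact: is_derive_cross (is_derive_N1 Dp) (is_derive_partial1 d12).
have [-> _] := partials_N Dp.
rewrite -fxyC (f_xy Dp) crossZr cross_self scaler0 addr0 crossC cross_cross.
rewrite [dot (partial2 f p) (N p)]dotC Nb scale0r sub0r opprK dotC.
by rewrite dot_partials.
Qed.

(** For a differentiable normal everything follows from the Weingarten
equations: N_x = f_x x N and N_y = N x f_y are continuous because f_x, f_y and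
N are, and crossing them with N gives back f_x and - f_y. *)
Lemma asymptotic_chebyshev_normal :
  C1M D N /\
  forall p, D p ->
    [/\ partial2 (partial1 N) p = cos (theta p) *: N p,
        partial1 (partial2 N) p = cos (theta p) *: N p,
        partial1 f p = cross (N p) (partial1 N p) &
        partial2 f p = - cross (N p) (partial2 N p)].
Proof.
have NxyE p : D p -> partial2 (partial1 N) p = cos (theta p) *: N p.
  by move=> /is_derive_partial1_N/partial2_val.
have NyxE p : D p -> partial1 (partial2 N) p = cos (theta p) *: N p.
  by move=> /is_derive_partial2_N/partial1_val.
have cN p : D p -> {for p, continuous N}.
  by move=> /N_diff; exact: differentiable_continuous.
(* The mixed derivative cos theta N is continuous because
   cos theta = <f_x, f_y>. *)
have cfN p : D p ->
    {for p, continuous (fun q => dot (partial1 f q) (partial2 f q) *: N q)}.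
  move=> Dp; have [/(_ p Dp)[_ c1 c2] _] := f_C1M.
  exact: continuousZ (continuous_dot c1 c2) (cN _ Dp).
split; last first.
  move=> p Dp; have [NN Na Nb _] := frame_at Dp.
  have [-> ->] := partials_N Dp.
  split; [exact: NxyE|exact: NyxE| |].
    by rewrite cross_cross NN Na scale1r scale0r subr0.
  by rewrite cross_cross NN Nb scale1r scale0r sub0r opprK.
split=> p Dp.
  have [/(_ p Dp)[_ c1 c2] _] := f_C1M.
  split; first exact: N_diff.
    apply: near_eq_continuous (continuous_cross c1 (cN _ Dp)).
    by apply: near_open D_open _ Dp => q /partials_N[].
  apply: near_eq_continuous (continuous_cross (cN _ Dp) c2).
  by apply: near_open D_open _ Dp => q /partials_N[].
split.
- by have [] := is_derive_partial1_N Dp.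
- by have [] := is_derive_partial2_N Dp.
- apply: near_eq_continuous (cfN _ Dp).
  by apply: near_open D_open _ Dp => q Dq; rewrite NxyE// dot_partials.
- apply: near_eq_continuous (cfN _ Dp).
  by apply: near_open D_open _ Dp => q Dq; rewrite NyxE// dot_partials.
- by rewrite NxyE// NyxE.
Qed.

End AsymptoticChebyshev.

#[local] Opaque dot cross enorm partial1 partial2.

Theorem theorem4p4 (R : realType)
    (Duv Duv' Dxy : set 'rV[R]_2)
    (forig f N : 'rV[R]_2 -> 'rV[R]_3)
    (T : 'rV[R]_2 -> 'rV[R]_2) (theta : 'rV[R]_2 -> R)
    (Duv_open : open Duv) (Duv_sc : simply_connected Duv)
    (forig_C2 : C2 Duv forig) (forig_regular : regular Duv forig)
    (forig_K : forall q, Duv q -> gauss_curvature forig q = -1)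
    (Dxy_domain : domain Dxy) (Duv'_domain : domain Duv')
    (Duv'_sub : Duv' `<=` Duv)
    (T_diffeo : C1_diffeomorphism Dxy Duv' T)
    (f_def : forall p, Dxy p -> f p = forig (T p))
    (f_C1M : C1M Dxy f)
    (f_asymptotic : asymptotic_coords Dxy f) (f_chebyshev : chebyshev_coords Dxy f)
    (theta_angle : forall p, Dxy p ->
       is_angle (partial1 f p) (partial2 f p) (theta p))
    (N_def : forall p, Dxy p ->
       N p = (sin (theta p))^-1 *: cross (partial1 f p) (partial2 f p))
    (f_xy : forall p, Dxy p ->
       partial2 (partial1 f) p = sin (theta p) *: N p) :
  C1M Dxy N /\
  forall p, Dxy p ->
    [/\ partial2 (partial1 N) p = cos (theta p) *: N p,
        partial1 (partial2 N) p = cos (theta p) *: N p,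
        partial1 f p = cross (N p) (partial1 N p) &
        partial2 f p = - cross (N p) (partial2 N p)].
Proof.
have [Dxy_open _ _] := Dxy_domain.
have [S [T_C1 _ TD _]] := T_diffeo.
have [forig_C1 forig1_C1 forig2_C1] := forig_C2.
have DT q : Dxy q -> Duv (T q) by move=> /TD[] /Duv'_sub.
have f_comp q : Dxy q -> f q = (forig \o T) q by exact: f_def.
have unit_normalN := unit_normalE f_chebyshev theta_angle N_def.
apply: (asymptotic_chebyshev_normal Dxy_open f_C1M f_asymptotic f_chebyshev
  theta_angle N_def f_xy) => p Dp.
have fT := near_open Dxy_open f_comp Dp.
(* Replace N by the normal of forig \o T, to which the chain rule applies. *)
have NfT q : Dxy q -> unit_normal (forig \o T) q = N q.
  move=> Dq; rewrite -(unit_normalN q Dq); apply/esym.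
  exact: near_eq_unit_normal (near_open Dxy_open f_comp Dq).
apply: near_eq_differentiable (near_open Dxy_open NfT Dp) _.
have [_ cT1 cT2] := T_C1 p Dp.
have [d1 _ _] := forig1_C1 _ (DT p Dp).
have [d2 _ _] := forig2_C1 _ (DT p Dp).
have dT : \near p, differentiable T p.
  by apply: near_open Dxy_open _ Dp => q /T_C1[].
have dforig : \near p, differentiable forig (T p).
  by apply: near_open Dxy_open _ Dp => q /DT/forig_C1[].
suff w0 : cross (partial1 (forig \o T) p) (partial2 (forig \o T) p) != 0.
  exact: (differentiable_unit_normal_comp dT dforig cT1 cT2 d1 d2 w0).
rewrite -(near_eq_partial1 fT) -(near_eq_partial2 fT).
have [sin0 _ w] := angle_at f_chebyshev theta_angle Dp.
apply/eqP => w0; move: sin0.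
by rewrite -w w0 -[X in enorm X](scale0r 0) enormZ normr0 mul0r ltxx.
Qed.
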